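(* Let $G$ be a finite group and assume that $(xy)^G=x^Gy^G$ for every $x,y\in G$ of prime power order with $(o(x),o(y))=1$. Then $G$ is solvable.
   Context: For $g\in G$, $g^G$ denotes the conjugacy class of $g$ in $G$ and $o(g)$ denotes the order of $g$; $(m,n)$ denotes the greatest common divisor of the integers $m,n$. The product $x^Gy^G$ is the set $\{uv : u\in x^G,\ v\in y^G\}$. *)

(* Defs.v *)
From mathcomp Require Import all_boot all_fingroup all_solvable.

Set Implicit Arguments.
Unset Strict Implicit.
Unset Printing Implicit Defensive.

(* The exponent 0 is allowed, so the identity element of a group has prime     *)
(* power order.                                                                *)
Definition prime_power (n : nat) : Prop :=
  exists p k : nat, prime p /\ n = p ^ k.

(* Main.v *)
Require Import Defs.
From mathcomp Require Import all_boot all_fingroup all_solvable.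
From mathcomp Require Import vcharacter.

Set Implicit Arguments.
Unset Strict Implicit.
Unset Printing Implicit Defensive.

Local Open Scope group_scope.

(** The class hypothesis is used through one kind of pair only.  If a q-element
    y normalises a p-subgroup P, with p <> q, and t lies in P, then the
    commutator x = [~ y, t] lies in P and y * x = y ^ t is conjugate to y.  The
    hypothesis then reads y^G x^G = y^G, so y^G is stable under right
    multiplication by the normal subgroup generated by x^G.  When y and P lie in
    a minimal normal subgroup N of G and x is not 1, that subgroup is N itself;
    it contains y^-1, so 1 lies in y^G and y = 1, which is absurd.  Hence, in N,
    no q-element acts nontrivially on a p-subgroup
    ([minnormal_trivial_coprime_action]).

    A group N with this property is nilpotent
    ([nilpotent_of_trivial_coprime_action]).  The property passes to subgroups,
    so in a minimal counterexample every proper subgroup is nilpotent, and such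
    a group is solvable by a theorem of Schmidt ([Schmidt_solvable]).  It thus
    has a nilpotent normal subgroup K of prime index p, and a Sylow p-subgroup P
    centralises the p'-part L of K, whence the whole group is the central
    product of P and L.

    Finally, the hypothesis passes to G / N, because elements of prime power
    order lift to elements of prime power order for the same prime
    ([class_product_quotient]), and G is solvable by induction on its order. *)

(** * Groups all of whose proper subgroups are nilpotent *)

(** Normalisers grow in the nilpotent groups M and L.  Hence, for a nontrivial
    intersection of largest order, any maximal subgroup that contains its
    normaliser meets both M and L in something larger and so equals both.  The
    induction on the colength of the intersection replaces the choice of a
    largest one. *)
Lemma maximal_TI (gT : finGroupType) (G M L : {group gT}) :
    (forall H : {group gT}, H \proper G -> nilpotent H) ->
    (forall K : {group gT}, K <| G -> K \proper G -> K :=: 1) ->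
  maximal M G -> maximal L G -> M != L -> M :&: L = 1.
Proof.
move=> nilG simpG; have [m] := ubnP (#|G| - #|M :&: L|).
elim: m M L => // m IHm M L /ltnSE-lem maxM maxL neqML.
apply/eqP/idPn => ntD; set D := (M :&: L)%G.
have prM := maxgroupp maxM.
have sDG : D \subset G by rewrite subIset ?(proper_sub prM).
have prD (A B : {group gT}) : maximal A G -> maximal B G -> A != B ->
    A :&: B \proper A.
  move=> maxA maxB neqAB; rewrite properE subsetIl subsetI subxx /=.
  apply: contra neqAB => sAB; apply/eqP/group_inj.
  by case/maxgroupP: maxA => _ /(_ B (maxgroupp maxB) sAB).
have prDM : D \proper M by apply: prD.
have prDL : D \proper L by rewrite /D /= setIC prD // eq_sym.
have prND : 'N_G(D) \proper G.
  rewrite properE subsetIl subsetI subxx /=; apply: contra ntD => nDG.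
  by rewrite (simpG D) // /normal ?sDG // (proper_sub_trans prDM) ?proper_sub.
have [defN | [X maxX sNX]] := maximal_exists (proper_sub prND).
  by rewrite /= defN properxx in prND.
(* A :&: X contains 'N_A(D), which is larger than D as A is nilpotent. *)
have eqX (A : {group gT}) : maximal A G -> D \proper A -> A = X.
  move=> maxA prDA; apply/eqP/idPn => neqAX.
  have prA := maxgroupp maxA.
  have prDN := nilpotent_proper_norm (nilG A prA) prDA.
  have prDAX : D \proper A :&: X.
    apply: (proper_sub_trans prDN); rewrite subsetI subsetIl /=.
    by apply: subset_trans sNX; rewrite setSI ?proper_sub.
  have AX1 : A :&: X = 1.
    apply: IHm => //; apply: leq_trans lem.
    by rewrite ltn_sub2l ?proper_card // (sub_proper_trans _ prA) ?proper_sub.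
  by case/negP: ntD; rewrite -subG1 -AX1 proper_sub.
by case/negP: neqML; rewrite (eqX M) // (eqX L).
Qed.

(** A proper nontrivial normal subgroup gives an induction step.  Otherwise the
    maximal subgroups are self-normalising with trivial pairwise intersections,
    so a nontrivial one is a Frobenius complement, and Frobenius' theorem
    provides a proper nontrivial normal subgroup after all. *)
Lemma Schmidt_solvable (gT : finGroupType) (G : {group gT}) :
    (forall H : {group gT}, H \proper G -> nilpotent H) ->
  solvable G.
Proof.
have [m] := ubnP #|G|; elim: m gT G => // m IHm gT G /ltnSE-lem nilG.
have [/existsP[K /and3P[nsKG prKG ntK]] | simpG] :=
  boolP [exists K : {group gT}, [&& K <| G, K \proper G & K :!=: 1]].
  rewrite (series_sol nsKG) nilpotent_sol ?nilG //=; apply: IHm.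
    by rewrite (leq_trans _ lem) ?ltn_quotient ?normal_sub.
  move=> Hb prHb.
  have [H defHb sKH sHG] := inv_quotientS nsKG (proper_sub prHb).
  rewrite defHb quotient_nil ?nilG // properE sHG.
  by move: prHb; rewrite defHb => /andP[_]; apply: contra; apply: quotientS.
have {}simpG (K : {group gT}) : K <| G -> K \proper G -> K :=: 1.
  move=> nsKG prKG; apply: contraNeq simpG => ntK.
  by apply/existsP; exists K; apply/and3P.
have [-> | /trivgPn[x Gx ntx]] := eqsVneq G 1; first exact: solvable1.
(* Starting from a cycle ensures that the maximal subgroup is nontrivial. *)
have sxG : <[x]> \subset G by rewrite cycle_subG.
have [defG | [M maxM sxM]] := maximal_exists sxG.
  by rewrite -defG abelian_sol ?cycle_abelian.
have prM := maxgroupp maxM.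
have ntM : M :!=: 1.
  by apply: contraNneq ntx => M1; rewrite -cycle_eq1 -subG1 -M1.
have [K frobG] : {K : {group gT} | [Frobenius G = K ><| M]}.
  apply: Frobenius_kernel_exists.
  rewrite /Frobenius_group_with_complement proper_neq //=.
  apply/normedTI_memJ_P; split; rewrite ?setD_eq0 ?subG1 ?proper_sub //.
  move=> a g /setD1P[nta Ma] Gg; rewrite !inE conjg_eq1 nta /=.
  apply/idP/idP => [Mag | Mg]; last by rewrite groupJ.
  apply: contraR ntM => notMg.
  have nMg : g \in 'N(M).
    apply: contraR nta => notNg; rewrite -[a == 1](conjg_eq1 a g) -in_set1.
    rewrite -set1gE -(@maximal_TI _ G M (M :^ g)%G) ?inE ?Mag ?memJ_conjg //.
      by rewrite -(conjGid Gg) maximalJ.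
    apply: contra notNg => /eqP defM; apply/normP.
    exact: esym (congr1 val defM).
  have [defN | [X maxX sNX]] := maximal_exists (subsetIl G 'N(M)).
    by rewrite (simpG M) // /normal proper_sub //= -{1}defN subsetIr.
  have [_ maxMG] := maxgroupP maxM; case/negP: notMg.
  have sMX : M \subset X.
    by rewrite (subset_trans _ sNX) // subsetI normG proper_sub.
  by rewrite -(maxMG X (maxgroupp maxX) sMX) (subsetP sNX) // inE Gg.
have [defG ntK _ prKG _] := Frobenius_context frobG.
have [nsKG _ _ _ _] := sdprod_context defG.
by rewrite (simpG K) ?eqxx in ntK.
Qed.

(** * Groups with trivial coprime action on their p-subgroups *)

(** The hypothesis passes to subgroups, so by induction all proper subgroups are
    nilpotent and Schmidt's theorem yields a nilpotent normal subgroup K of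
    prime index p.  The primary parts of 'O_p^'(K) lie in the cores 'O_q(K),
    normal in G, which the p-elements of G centralise. *)
Lemma nilpotent_of_trivial_coprime_action (gT : finGroupType) (G : {group gT}) :
    (forall (p q : nat) (P : {group gT}) (y : gT), p != q ->
       p.-group P -> q.-elt y -> P \subset G -> y \in 'N_G(P) -> y \in 'C(P)) ->
  nilpotent G.
Proof.
have [m] := ubnP #|G|; elim: m G => // m IHm G /ltnSE-lem cGP.
have nilG (H : {group gT}) : H \proper G -> nilpotent H.
  move=> prHG; have sHG := proper_sub prHG.
  apply: IHm => [|p q P y neqpq pP q_y sPH nPy].
    exact: leq_trans (proper_card prHG) lem.
  apply: (cGP p q) => //; first exact: subset_trans sPH sHG.
  exact: subsetP (setSI _ sHG) _ nPy.
have [-> | ntG] := eqsVneq G 1; first exact: nilpotent1.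
have [K nsKG prGK] := sol_prime_factor_exists (Schmidt_solvable nilG) ntG.
have sKG := normal_sub nsKG.
have nilK : nilpotent K.
  apply: nilG; rewrite properE sKG /=; apply: contraL prGK => sGK.
  by rewrite (eqP (_ : #|G : K| == 1%N)) // indexg_eq1.
set p := #|G : K| in prGK; have [P sylP] := Sylow_exists p G.
set L := 'O_p^'(K).
have nsLG : L <| G by apply: char_normal_trans nsKG; apply: pcore_char.
have cPL : P \subset 'C(L).
  rewrite centsC; apply/subsetP=> z Lz; apply/centP => y Py.
  have Kz : z \in K := subsetP (pcore_sub _ _) z Lz.
  apply/cent1P; rewrite -[z]prod_constt group_prod // => q _.
  have [-> | neqqp] := eqVneq q p.
    by rewrite (constt1P _) ?group1 // (mem_p_elt (pcore_pgroup _ _) Lz).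
  have Oz : z.`_q \in 'O_q(K).
    rewrite (mem_normal_Hall (nilpotent_pcore_Hall q nilK) (pcore_normal _ _)).
      exact: p_elt_constt.
    exact: groupX.
  have nsOG : 'O_q(K) <| G by apply: char_normal_trans nsKG; apply: pcore_char.
  have Gy := subsetP (pHall_sub sylP) y Py.
  have cOy : y \in 'C('O_q(K)).
    apply: (cGP q p 'O_q(K)%G) => //.
    - exact: pcore_pgroup.
    - exact: mem_p_elt (pHall_pgroup sylP) Py.
    - exact: normal_sub nsOG.
    - by rewrite inE Gy (subsetP (normal_norm nsOG)).
  by apply/cent1P/commute_sym/(centP cOy).
have defG : P * L = G.
  apply/eqP; rewrite eqEcard mul_subG ?(pHall_sub sylP) ?normal_sub //=.
  rewrite TI_cardMg; last first.
    apply: coprime_TIg.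
    exact: pnat_coprime (pHall_pgroup sylP) (pcore_pgroup _ _).
  rewrite (card_Hall sylP) (card_Hall (nilpotent_pcore_Hall _ nilK)).
  rewrite -{1}(partnC p (cardG_gt0 G)) leq_mul2l; apply/orP; right.
  rewrite -(Lagrange sKG) partnM ?cardG_gt0 // -/p.
  by rewrite (@part_p'nat p^' p) ?muln1 // pnatNK pnat_id.
rewrite centsC in cPL.
rewrite -defG (mulg_nil cPL) (pgroup_nil (pHall_pgroup sylP)).
exact: nilpotentS (pcore_sub _ _) nilK.
Qed.

(** * Products of conjugacy classes *)

Definition class_product_property (gT : finGroupType) (G : {group gT}) :=
  forall x y : gT, x \in G -> y \in G ->
    prime_power #[x] -> prime_power #[y] -> coprime #[x] #[y] ->
    (x * y) ^: G = (x ^: G) * (y ^: G).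

(** The predicate [p.-elt x] makes sense for any number p; it forces x = 1 when
    p is not a prime. *)
Lemma p_elt_prime_power (gT : finGroupType) (p : nat) (x : gT) :
  p.-elt x -> prime_power #[x].
Proof.
case: (boolP (prime p)) => [pr_p /p_natP[k ox] | npr_p p_x].
  by exists p, k.
exists 2, 0; split=> //; rewrite expn0.
apply/eqP; rewrite -(part_pnat_id p_x) p_part_eq1.
by apply: contra npr_p; rewrite mem_primes => /andP[].
Qed.

(** A lift of an element of prime power order can be replaced by its part for
    the same prime, and coprimality of the orders is preserved. *)
Lemma class_product_quotient (gT : finGroupType) (G N : {group gT}) :
  N <| G -> class_product_property G -> class_product_property (G / N)%G.
Proof.
move=> nsNG hG.
(* Taking the part for \pi(#[xb]), rather than for p, lifts 1 to 1: a
   nontrivial lift of 1 could spoil coprimality. *)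
have lift xb : xb \in G / N -> prime_power #[xb] ->
    exists x, [/\ x \in G, x \in 'N(N), prime_power #[x], coset N x = xb
                & \pi(#[xb]).-elt x].
  case/morphimP => x0 Nx0 Gx0 def_xb [p [k [pr_p oxb]]].
  have pi_x := p_elt_constt \pi(#[xb]) x0.
  exists x0.`_\pi(#[xb]); split; rewrite ?groupX //.
    have xb_p : p.-elt xb by rewrite /p_elt oxb pnatX pnat_id.
    apply: (@p_elt_prime_power _ p); apply: sub_in_pnat pi_x => r _.
    exact: pnatPpi xb_p.
  rewrite morph_constt // -[coset_morphism _ _]/(coset N x0) -def_xb.
  rewrite constt_p_elt //.
  by rewrite /p_elt pnat_pi.
move=> xb yb /lift liftx /lift lifty /liftx[x [Gx Nx pp_x <- pi_x]].
move=> /lifty[y [Gy Ny pp_y <- pi_y]] co_xyb.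
have co_xy : coprime #[x] #[y].
  apply: pnat_coprime pi_x _; apply: sub_in_pnat pi_y => r _.
  by apply: pnatPpi; rewrite -coprime_pi' ?order_gt0.
have sGN := normal_norm nsNG.
rewrite -morphM // -!quotient_class ?groupM // hG //.
by rewrite quotientMl // class_subG.
Qed.

Lemma mulg_stable_gen (gT : finGroupType) (A B : {set gT}) :
  B * A = B -> B * <<A>> = B.
Proof.
move=> BA.
(* The stabiliser of B under right translation is a group. *)
have sAN : A \subset 'N(B | 'R).
  apply/subsetP=> a Aa; rewrite !inE; apply/subsetP => b Bb.
  by rewrite inE /= -BA mem_mulg.
apply/eqP; rewrite eqEsubset mulg_subl ?group1 // andbT.
apply/subsetP=> _ /mulsgP[b a Bb Aa ->].
have Na : a \in 'N(B | 'R) by apply: subsetP Aa; rewrite gen_subG.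
by have /= -> := astabs_act b Na.
Qed.

(** For a commutator x = [~ y, t] with t in P, the product y * x is the
    conjugate y ^ t, so the class hypothesis makes y^G stable under <<x^G>>.  By
    minimality of N this is all of N unless x = 1, but N contains y^-1, and
    y^G does not contain 1. *)
Lemma minnormal_trivial_coprime_action (gT : finGroupType) (G N : {group gT}) :
    class_product_property G -> N \subset G -> minnormal N G ->
  forall (p q : nat) (P : {group gT}) (y : gT), p != q ->
    p.-group P -> q.-elt y -> P \subset N -> y \in 'N_N(P) -> y \in 'C(P).
Proof.
move=> hG sNG /mingroupP[/andP[ntN nNG] minN] p q P y.
move=> neqpq pP q_y sPN /setIP[Ny nPy].
apply/idPn => ncPy.
have [t Pt ntx] : exists2 t, t \in P & [~ y, t] != 1.
  apply/exists_inP; apply: contraR ncPy => /exists_inPn cPy.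
  apply/centP => t Pt; apply/commgP; by have /negPn := cPy t Pt.
set x := [~ y, t] in ntx.
have Px : x \in P by rewrite /x commgEr groupM // memJ_norm ?groupV.
have Nx := subsetP sPN x Px.
have [Gy Gx] := (subsetP sNG y Ny, subsetP sNG x Nx).
have classM : y ^: G * x ^: G = y ^: G.
  rewrite -hG //.
  - by rewrite /x commgEl mulKVg classGidl // (subsetP sNG) // (subsetP sPN).
  - exact: p_elt_prime_power q_y.
  - exact: p_elt_prime_power (mem_p_elt pP Px).
  - apply: pnat_coprime q_y _.
    by apply: sub_in_pnat (mem_p_elt pP Px) => r _ /eqP->; rewrite !inE.
have sXN : x ^: G \subset N by rewrite class_sub_norm.
have defN : <<x ^: G>> = N.
  apply: minN; last by rewrite gen_subG.
  rewrite norms_gen ?class_norm // andbT.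
  apply: contraNneq ntx => X1; rewrite -in_set1 -set1gE -X1.
  by rewrite mem_gen ?class_refl.
have: y * y^-1 \in y ^: G.
  by rewrite -(mulg_stable_gen classM) defN mem_mulg ?class_refl ?groupV.
rewrite mulgV => /imsetP[z Gz /esym/eqP]; rewrite conjg_eq1 => /eqP y1.
by rewrite /x y1 comm1g eqxx in ntx.
Qed.

Theorem theoremB (gT : finGroupType) (G : {group gT})
  (hG : forall x y : gT, x \in G -> y \in G ->
     prime_power #[x] -> prime_power #[y] -> coprime #[x] #[y] ->
     (x * y) ^: G = (x ^: G) * (y ^: G)) :
  solvable G.
Proof.
have [m] := ubnP #|G|; elim: m gT G hG => // m IHm gT G hG /ltnSE-lem.
have [-> | ntG] := eqsVneq G 1; first exact: solvable1.
have [N minN sNG] := minnormal_exists ntG (normG G).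
have [/andP[ntN nNG] _] := mingroupP minN.
have nsNG : N <| G by apply/andP.
rewrite (series_sol nsNG) nilpotent_sol /=.
  apply: IHm; first exact: class_product_quotient.
  by rewrite (leq_trans _ lem) ?ltn_quotient.
apply: nilpotent_of_trivial_coprime_action.
exact: minnormal_trivial_coprime_action hG sNG minN.
Qed.
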